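(* Let $X \subset \mathbb{P}^N$ be a concise irreducible projective variety over $\mathbb{C}$. Then the following are equivalent: (1) the generic $X$-Hadamard-rank is infinite, i.e., $X^{\star m} \subsetneq \mathbb{P}^N$ for all $m \geq 1$; (2) $X$ is contained in a proper binomial hypersurface of $\mathbb{P}^N$; (3) the ideal of $X$ contains binomials (i.e., at least one binomial).
   Context: Homogeneous coordinates $x_0,\ldots,x_N$ on $\mathbb{P}^N=\mathbb{P}^N_{\mathbb{C}}$ are fixed. $X$ is concise if it is not contained in any coordinate hyperplane $\{x_i=0\}$. The Hadamard product of points is $(p_0:\cdots:p_N)\star(q_0:\cdots:q_N)=(p_0q_0:\cdots:p_Nq_N)$, defined whenever the right-hand side is not identically zero. For projective varieties $X,Y\subset\mathbb{P}^N$, $X\star Y$ is the Zariski closure of $\{p\star q : p\in X,\ q\in Y,\ p\star q \text{ exists}\}$; $X^{\star 0}=\{(1:\cdots:1)\}$ and $X^{\star m}=X\star X^{\star(m-1)}$. The $X$-Hadamard-rank $\mathrm{Hrk}_X(p)$ of $p\in\mathbb{P}^N$ is the smallest $m\ge 1$ such that $p=q_1\star\cdots\star q_m$ with $q_i\in X$ (and $\infty$ if there is none); $\eta_m(X)$ is the Zariski closure of $\{p : \mathrm{Hrk}_X(p)\le m\}$. The generic $X$-Hadamard-rank is the smallest $m\ge1$ such that $\eta_m(X)=\mathbb{P}^N$, and it is infinite if no such $m$ exists. A binomial is a polynomial $a\mathbf{x}^\alpha+b\mathbf{x}^\beta$ with $a,b\in\mathbb{C}\smallsetminus\{0\}$ and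 $\alpha\neq\beta$ exponent vectors with entries in $\mathbb{Z}_{\ge0}$; a binomial hypersurface of $\mathbb{P}^N$ is the zero locus of a homogeneous binomial. *)

(* Defs.v *)
From HB Require Import structures.
From mathcomp Require Import all_boot all_order all_algebra.
From mathcomp Require Import boolp classical_sets reals.
From mathcomp Require Import complex.
From mathcomp Require Import mpoly.

Set Implicit Arguments.
Unset Strict Implicit.
Unset Printing Implicit Defensive.

Import GRing.Theory.
Local Open Scope ring_scope.
Local Open Scope quotient_scope.
Local Open Scope classical_set_scope.

Section ProjectiveSpace.
Variables (K : fieldType) (N : nat).

Definition nzvec : Type := {v : 'rV[K]_N.+1 | v != 0}.

Definition hc (v : nzvec) (i : 'I_N.+1) : K := val v ord0 i.

Definition proportional (u v : nzvec) : bool :=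
  `[< exists2 c : K, c != 0 & val u = c *: val v >].

Lemma proportional_refl : reflexive proportional.
Proof. by move=> u; apply/asboolP; exists 1; rewrite ?oner_eq0 ?scale1r. Qed.

Lemma proportional_sym : ssrbool.symmetric proportional.
Proof.
have imp u v : proportional u v -> proportional v u.
  move=> /asboolP[c c0 uv]; apply/asboolP; exists c^-1; rewrite ?invr_eq0 //.
  by rewrite uv scalerA mulVf // scale1r.
by move=> u v; apply/idP/idP; exact: imp.
Qed.

Lemma proportional_trans : transitive proportional.
Proof.
move=> v u w /asboolP[c c0 uv] /asboolP[d d0 vw]; apply/asboolP.
by exists (c * d); rewrite ?mulf_neq0 // uv vw scalerA.
Qed.

Canonical proportional_equiv :=
  EquivRel proportional proportional_refl proportional_sym proportional_trans.

Definition pspace : Type := {eq_quot proportional_equiv}.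

(* The point with homogeneous coordinates v. *)
Definition pt (v : nzvec) : pspace := \pi_({eq_quot proportional_equiv}) v.

(* All coordinate vectors of p are tested; for a homogeneous f one suffices. *)
Definition vanishes (f : {mpoly K[N.+1]}) (p : pspace) : Prop :=
  forall v, pt v = p -> f.@[hc v] = 0.

Definition homogeneous (f : {mpoly K[N.+1]}) : Prop :=
  exists d : nat, f \is d.-homog.

Definition zero_locus (S : set {mpoly K[N.+1]}) : set pspace :=
  [set p | forall f, S f -> vanishes f p].

Definition zclosed (A : set pspace) : Prop :=
  exists2 S : set {mpoly K[N.+1]}, S `<=` homogeneous & A = zero_locus S.

Definition zclosure (A : set pspace) : set pspace :=
  [set p | forall B, zclosed B -> A `<=` B -> B p].

Definition zirreducible (A : set pspace) : Prop :=
  A !=set0 /\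
  forall B C, zclosed B -> zclosed C -> A `<=` B `|` C -> A `<=` B \/ A `<=` C.

Definition irreducible_projective_variety (X : set pspace) : Prop :=
  zclosed X /\ zirreducible X.

(* The homogeneous ideal of X: since its elements need not be homogeneous, they
   are required to vanish on the whole affine cone over X. *)
Definition ideal_of (X : set pspace) : set {mpoly K[N.+1]} :=
  [set f | forall p, X p -> vanishes f p].

Definition coordinate_hyperplane (i : 'I_N.+1) : set pspace :=
  zero_locus [set 'X_i].

Definition concise (X : set pspace) : Prop :=
  forall i, ~ X `<=` coordinate_hyperplane i.

Definition is_binomial (f : {mpoly K[N.+1]}) : Prop :=
  exists (a b : K) (alpha beta : 'X_{1..N.+1}),
    [/\ a != 0, b != 0, alpha != beta & f = a *: 'X_[alpha] + b *: 'X_[beta]].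

Definition binomial_hypersurface (H : set pspace) : Prop :=
  exists f, [/\ is_binomial f, homogeneous f & H = zero_locus [set f]].

(* "p \star q exists and equals r": w ranges over nonzero vectors, so there is
   no such r when the coordinatewise product vanishes identically. *)
Definition is_hprod (p q r : pspace) : Prop :=
  exists u v w, [/\ pt u = p, pt v = q, pt w = r
                  & forall i, hc w i = hc u i * hc v i].

(* "p = q_1 \star ... \star q_m"; if the coordinatewise product of all the
   factors is nonzero then so are all the partial products. *)
Definition is_hprodn (m : nat) (q : 'I_m -> pspace) (p : pspace) : Prop :=
  exists (u : 'I_m -> nzvec) (w : nzvec),
    [/\ forall j, pt (u j) = q j, pt w = p
      & forall i, hc w i = \prod_(j < m) hc (u j) i].

Definition hstar (X Y : set pspace) : set pspace :=
  zclosure [set r | exists p q, [/\ X p, Y q & is_hprod p q r]].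

Definition ones : set pspace :=
  [set p | exists2 v, pt v = p & forall i, hc v i = 1].

Fixpoint hpower (X : set pspace) (m : nat) : set pspace :=
  if m is m'.+1 then hstar X (hpower X m') else ones.

(* The least natural number satisfying P; None stands for infinity. *)
Definition least (P : nat -> Prop) : option nat :=
  match pselect (exists n, `[< P n >]) with
  | left exP => Some (ex_minn exP)
  | right _ => None
  end.

Definition Hrk (X : set pspace) (p : pspace) : option nat :=
  least (fun m => (1 <= m)%N /\
    exists q : 'I_m -> pspace, (forall j, X (q j)) /\ is_hprodn q p).

Definition eta (X : set pspace) (m : nat) : set pspace :=
  zclosure [set p | exists2 k, Hrk X p = Some k & (k <= m)%N].

Definition generic_Hrk (X : set pspace) : option nat :=
  least (fun m => (1 <= m)%N /\ eta X m = setT).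

End ProjectiveSpace.

(* Main.v *)
Require Import Defs.
From HB Require Import structures.
From mathcomp Require Import all_boot all_order all_algebra.
From mathcomp Require Import boolp classical_sets reals.
From mathcomp Require Import complex.
From mathcomp Require Import mpoly.
From mathcomp Require Import zify.

(** Work with the affine cone over X and the coordinatewise product of vectors.

    If a binomial [c x^a + d x^b] vanishes on the cone, then [x^a] and [x^b]
    are proportional there, so they stay proportional on k-fold products:
    these lie on [c^k x^a = (-d)^k x^b], a hypersurface again
    ([setvpow_binomial]). Hence no power of X, and no finite union of powers,
    is dense. A binomial in the ideal is automatically homogeneous: the cone
    contains a point with nonzero coordinates, and comparing the values at
    that point and at its double gives [2^|a| = 2^|b|]
    ([binomial_ideal_mdeg]).

    Conversely, suppose that no binomial vanishes on the cone. Divide the cone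
    by one of its points with nonzero coordinates; the resulting set D contains
    the unit vector, so its powers increase, and two distinct monomials never
    coincide on D. On the monoid generated by D the monomials are therefore
    pairwise distinct characters, and by Dedekind's independence of characters
    no nonzero polynomial vanishes on all powers of D
    ([characters_independent]). It remains to find a single power that is
    dense. The ideals of the powers of D are prime, because products of
    irreducible sets are irreducible ([prime_vanishM]), and they decrease.
    Descending chains of primes in [K[x_1, ..., x_n]] are stationary
    ([prime_dcc_mpoly]), so one of these ideals equals their intersection,
    which is 0. This chain condition replaces the usual dimension count. *)

Set Implicit Arguments.
Unset Strict Implicit.
Unset Printing Implicit Defensive.

Import Order.TTheory GRing.Theory Num.Theory.
Local Open Scope ring_scope.
Local Open Scope classical_set_scope.

(** * Descending chains of prime ideals *)

Definition prime_ideal (A : comNzRingType) (P : A -> Prop) : Prop :=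
  [/\ P 0, forall a b, P a -> P b -> P (a + b),
      forall a b, P b -> P (a * b), ~ P 1 &
      forall a b, P (a * b) -> P a \/ P b].

Definition prime_dcc (A : comNzRingType) : Prop :=
  forall P : nat -> A -> Prop,
    (forall k, prime_ideal (P k)) ->
    (forall k a, P k.+1 a -> P k a) ->
    exists m, forall k a, P m a -> P k a.

Lemma prime_ideal_exp (A : comNzRingType) (P : A -> Prop) a k :
  prime_ideal P -> P (a ^+ k) -> P a.
Proof.
case=> _ _ _ P1 Pp; elim: k => [|k IH]; first by rewrite expr0.
by rewrite exprS => /Pp[].
Qed.

Lemma prime_idealB (A : comNzRingType) (P : A -> Prop) a b :
  prime_ideal P -> P a -> P b -> P (a - b).
Proof.
by case=> _ PD PM _ _ Pa Pb; rewrite -mulN1r; apply: PD => //; apply: PM.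
Qed.

Lemma prime_ideal_preim (A B : comNzRingType) (f : {rmorphism A -> B})
    (P : B -> Prop) : prime_ideal P -> prime_ideal (fun a => P (f a)).
Proof.
case=> P0 PD PM P1 Pp; split; rewrite ?rmorph0 ?rmorph1 //.
- by move=> a b; rewrite rmorphD; apply: PD.
- by move=> a b; rewrite rmorphM; apply: PM.
- by move=> a b; rewrite rmorphM; apply: Pp.
Qed.

Lemma chain_le (A : Type) (P : nat -> A -> Prop) :
  (forall k a, P k.+1 a -> P k a) ->
  forall j k a, (j <= k)%N -> P k a -> P j a.
Proof.
move=> Pdec j k a; elim: k => [|k IH]; first by rewrite leqn0 => /eqP ->.
by rewrite leq_eqVlt => /predU1P[->//|jk /Pdec]; apply: IH.
Qed.

Lemma prime_dcc_surj (A B : comNzRingType) (f : {rmorphism A -> B}) :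
  (forall b, exists a, f a = b) -> prime_dcc A -> prime_dcc B.
Proof.
move=> fsurj dccA P Ppr Pdec.
have [|k a|m mP] := dccA (fun k a => P k (f a)).
- by move=> k; apply: prime_ideal_preim.
- exact: Pdec.
by exists m => k b; have [a <-] := fsurj b; apply: mP.
Qed.

Lemma exists_min_size (A : nzRingType) (S : {poly A} -> Prop) :
  (exists f, S f) ->
  exists2 f, S f & forall g : {poly A}, (size g < size f)%N -> ~ S g.
Proof.
move=> [f0 Sf0].
have exn : exists n, `[< exists2 f : {poly A}, S f & size f = n >].
  by exists (size f0); apply/asboolP; exists f0.
case: (ex_minnP exn) => n /asboolP[f Sf fn] nmin.
exists f => // g gf Sg; have : (n <= size g)%N.
  by apply: nmin; apply/asboolP; exists g.
by rewrite -fn leqNgt gf.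
Qed.

Lemma prime_ideal_coef (A : comNzRingType) (P : {poly A} -> Prop) (f : {poly A}) :
  prime_ideal P -> (forall i, P (f`_i)%:P) -> P f.
Proof.
case=> P0 PD PM _ _ Pf; rewrite -[f]coefK poly_def.
apply: (big_ind P) => // i _.
by rewrite -mul_polyC mulrC; apply: PM.
Qed.

(** Suppose that the contractions to A are equal to p from rank m0 on. If some
    P k with k >= m0 is p[X], so are the later ones. Otherwise take f of minimal
    degree in P m0 minus p[X]: its leading coefficient is outside p, so
    pseudo-division by f shows that P m0 consists, up to a multiplier outside p, of the
    multiples of f modulo p[X]. Minimality in a later P k, together with
    primality, puts f in P k; then P m0 is contained in P k. In classical
    terms, the fibre of the spectrum of A[X] over p is that of a polynomial
    ring in one variable over a field, which has dimension 1. *)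
Lemma prime_dcc_poly (A : idomainType) : prime_dcc A -> prime_dcc {poly A}.
Proof.
move=> dccA P Ppr Pdec.
have Pc k := prime_ideal_preim (polyC : {rmorphism A -> {poly A}}) (Ppr k).
have [m0 m0P] := dccA (fun k a => P k a%:P) Pc (fun k a => @Pdec k a%:P).
pose p a := P m0 a%:P.
have pP k a : (m0 <= k)%N -> P k a%:P <-> p a.
  by move=> mk; split; [apply: chain_le | apply: m0P].
have pk k a : p a -> P k a%:P by exact: m0P.
pose pX (f : {poly A}) := forall i, p f`_i.
have pXP k f : pX f -> P k f.
  by move=> pf; apply: prime_ideal_coef => // i; apply: pk.
have [p0 pD pM p1 pp] := Pc m0.
have pXD f g : pX f -> pX g -> pX (f + g).
  by move=> pf pg i; rewrite coefD; apply: pD; [exact: pf | exact: pg].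
have pXM f g : pX g -> pX (f * g).
  move=> pg i; rewrite coefM; apply: (big_ind p) => //.
  by move=> j _; apply/pM/pg.
case: (pselect (exists2 k, (m0 <= k)%N & forall f, P k f -> pX f))
  => [[k _ kP]|big].
  by exists k => j f /kP; apply: pXP.
have min k : (m0 <= k)%N ->
    exists2 f, P k f /\ ~ pX f &
      forall g : {poly A}, (size g < size f)%N -> P k g -> pX g.
  move=> mk; have [|f [Pf pf] fmin] :=
    @exists_min_size A (fun f => P k f /\ ~ pX f).
    apply: contrapT => no; apply: big; exists k => // f Pf.
    by apply: contrapT => pf; apply: no; exists f.
  by exists f => // g /fmin gf Pg; apply: contrapT => pg; apply: gf.
have [f [Pf pf] fmin] := min m0 (leqnn _).
have f0 : f != 0.
  by apply/eqP => f0; apply: pf => i; rewrite f0 coef0.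
(* Otherwise removing the leading term would contradict minimality. *)
have lcf : ~ p (lead_coef f).
  move=> plc; apply: pf.
  pose g := f - (lead_coef f)%:P * 'X^((size f).-1).
  have pl : pX ((lead_coef f)%:P * 'X^((size f).-1)).
    by rewrite mulrC; apply: pXM => i; rewrite coefC; case: ifP.
  have -> : f = g + (lead_coef f)%:P * 'X^((size f).-1) by rewrite subrK.
  apply: pXD => //; apply: fmin; last by apply: prime_idealB => //; apply: pXP.
  have sf : (0 < size f)%N by rewrite size_poly_gt0.
  rewrite -(prednK sf) ltnS; apply/leq_sizeP => j jf.
  rewrite coefB coefCM coefXn; case: (eqVneq j (size f).-1) => [->|nj].
    by rewrite mulr1 lead_coefE subrr.
  by rewrite mulr0 subr0 nth_default // -(prednK sf) ltn_neqAle eq_sym nj.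
(* A constant f would lie in the contraction p. *)
have sf : (1 < size f)%N.
  rewrite ltnNge; apply/negP => /size1_polyC fC.
  by move: lcf; rewrite fC lead_coefC => lcf; apply: lcf; rewrite /p -fC.
have pdiv h : exists s q r, [/\ (lead_coef f ^+ s)%:P * h = q * f + r,
    (size r < size f)%N & P m0 h -> pX r].
  case: (Pdiv.ComRing.redivpP h f) => s q r /= e /(_ f0) rf.
  exists s, q, r; split => //.
    by rewrite mul_polyC.
  move=> Ph; apply: fmin => //.
  have -> : r = (lead_coef f ^+ s)%:P * h - q * f.
    by rewrite mul_polyC e addrC addKr.
  have [_ _ PM _ _] := Ppr m0.
  by apply: prime_idealB => //; apply: PM.
have Pkf k : (m0 <= k)%N -> P k f.
  move=> mk; have [P0 PD PM P1 Pp] := Ppr k.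
  have [h [Ph ph] hmin] := min k mk.
  have Ph0 : P m0 h by apply: chain_le Ph.
  have [s [q [r [e rf /(_ Ph0) pr]]]] := pdiv h.
  have fh : (size f <= size h)%N.
    by rewrite leqNgt; apply/negP => /fmin/(_ Ph0).
  have : P k (q * f).
    have -> : q * f = (lead_coef f ^+ s)%:P * h - r by rewrite e addrK.
    by apply: prime_idealB => //; [apply: PM | apply: pXP].
  case/Pp => // Pq; exfalso.
  (* As f has positive degree, q is smaller than h, hence in p[X]; then so is
     h, whose multiplier is outside p. *)
  have qh : (size q < size h)%N.
    rewrite ltnNge; apply/negP => hq.
    have q0 : q != 0 by rewrite -size_poly_gt0; lia.
    have : (size (q * f)%R <= size h)%N.
      have -> : q * f = (lead_coef f ^+ s)%:P * h - r by rewrite e addrK.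
      rewrite (leq_trans (size_polyD _ _)) // size_polyN geq_max.
      rewrite mul_polyC (leq_trans (size_scale_leq _ _)) //=.
      by rewrite (leq_trans (ltnW rf)).
    rewrite size_mul //; move: hq sf.
    by move: (size q) (size f) (size h) => i j l; lia.
  have pq := hmin q qh Pq.
  apply: ph => i; have : p ((lead_coef f ^+ s) * h`_i).
    by rewrite -coefCM e; apply: pXD => //; rewrite mulrC; apply: pXM.
  by case/pp => // /(prime_ideal_exp (Pc m0)).
exists m0 => k h Ph.
case: (leqP k m0) => [km|/ltnW mk]; first exact: chain_le km Ph.
have [P0 PD PM P1 Pp] := Ppr k.
have [s [q [r [e rf /(_ Ph) pr]]]] := pdiv h.
have : P k ((lead_coef f ^+ s)%:P * h).
  by rewrite e; apply: PD; [apply/PM/Pkf | apply: pXP].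
by case/Pp => // /pP - /(_ mk) /(prime_ideal_exp (Pc m0)).
Qed.

(** The last variable is split off by viewing [K[x_0, ..., x_n]] as an image of
    [K[x_0, ..., x_(n-1)][X]]. *)
Lemma prime_dcc_mpoly (K : fieldType) n : prime_dcc {mpoly K[n]}.
Proof.
elim: n => [|n IH].
  move=> P Ppr _; exists 0%N => k f.
  have [P0 _ _ _ _] := Ppr k; have [_ _ PM P1 _] := Ppr 0%N.
  rewrite (nvar0_mpolyC f); have [->|c0 Pf] := eqVneq f@_0%MM 0.
    by rewrite mpolyC0.
  case: P1; rewrite -[1]mpolyC1 -(mulVf c0) mpolyCM; exact: PM.
pose psi : {rmorphism {poly {mpoly K[n]}} -> {mpoly K[n.+1]}} :=
  (horner_eval ('X_ord_max : {mpoly K[n.+1]}) \o map_poly (@mwiden n K)).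
apply: (prime_dcc_surj (f := psi)) (prime_dcc_poly IH) => f.
exists (muni f); rewrite muniE [RHS]mpolyE rmorph_sum; apply: eq_bigr => m _.
rewrite /psi /= map_polyZ map_polyXn /horner_eval hornerZ hornerXn.
rewrite -[X in X * _]/(mwiden _) mwidenZ -scalerAl; congr (_ *: _).
rewrite mwidenX mpolyXn -mpolyXD; congr 'X_[_].
apply/mnmP => i; rewrite mnmDE mulmnE mnm1E.
case: (unliftP ord_max i) => [j|] ->.
  rewrite (_ : lift ord_max j = widen_ord (leqnSn n) j); last first.
    by apply/val_inj; rewrite /= /bump leqNgt ltn_ord.
  rewrite mnmwiden_widen mnmE (_ : _ == _ = false) ?mul0n ?addn0 //.
  by rewrite -val_eqE /= gtn_eqF.
by rewrite mnmwiden_ordmax eqxx mul1n.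
Qed.

(** * Coordinatewise products and vanishing ideals *)

Section Affine.
Variables (K : fieldType) (n : nat).
Implicit Types (x y p : 'I_n -> K) (f g : {mpoly K[n]}) (S T : set ('I_n -> K)).

Definition vmul x y : 'I_n -> K := fun i => x i * y i.

Definition vone : 'I_n -> K := fun=> 1.

Definition vanish S f : Prop := forall x, S x -> f.@[x] = 0.

Definition setvmul S T : set ('I_n -> K) :=
  [set z | exists x y, [/\ S x, T y & z = vmul x y]].

Fixpoint setvpow S k : set ('I_n -> K) :=
  if k is k'.+1 then setvmul S (setvpow S k') else [set vone].

(** Translation by x in the monoid of vectors, seen on polynomials. *)
Definition mscale x : {mpoly K[n]} -> {mpoly K[n]} :=
  mmap (@mpolyC n K) (fun i => x i *: 'X_i).

HB.instance Definition _ x := GRing.RMorphism.on (mscale x).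

Lemma vmulA x y z : vmul x (vmul y z) = vmul (vmul x y) z.
Proof. by apply/funext => i; rewrite /vmul mulrA. Qed.

Lemma vmulC x y : vmul x y = vmul y x.
Proof. by apply/funext => i; rewrite /vmul mulrC. Qed.

Lemma vmul1 x : vmul vone x = x.
Proof. by apply/funext => i; rewrite /vmul mul1r. Qed.

Lemma mevalX_vmul m x y :
  ('X_[m] : {mpoly K[n]}).@[vmul x y] = 'X_[m].@[x] * 'X_[m].@[y].
Proof.
by rewrite !mevalX -big_split; apply: eq_bigr => i _; rewrite /= exprMn.
Qed.

Lemma mevalX_one m : ('X_[m] : {mpoly K[n]}).@[vone] = 1.
Proof. by rewrite mevalX big1 // => i _; rewrite expr1n. Qed.

Lemma mevalX_neq0 m x : (forall i, x i != 0) ->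
  ('X_[m] : {mpoly K[n]}).@[x] != 0.
Proof. by move=> x0; rewrite mevalX; apply/prodf_neq0 => i _; rewrite expf_neq0. Qed.

Lemma mscaleE x f : mscale x f =
  \sum_(m <- msupp f) (f@_m * 'X_[m].@[x]) *: 'X_[m].
Proof.
rewrite /mscale /mmap; apply: eq_bigr => m _; rewrite mul_mpolyC -scalerA.
congr (_ *: _); rewrite /mmap1 mevalX mpolyXE_id -scaler_prod.
by apply: eq_bigr => i _; rewrite exprZn.
Qed.

Lemma mcoeff_mscale x f m : (mscale x f)@_m = f@_m * 'X_[m].@[x].
Proof.
rewrite mscaleE linear_sum /=.
under eq_bigr do rewrite mcoeffZ mcoeffX.
have [mf|mf] := boolP (m \in msupp f).
  rewrite (bigD1_seq m) ?msupp_uniq //= eqxx mulr1 big1 ?addr0 //.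
  by move=> i /negbTE ->; rewrite mulr0.
rewrite (memN_msupp_eq0 mf) mul0r big_seq big1 // => i fi.
by rewrite (_ : i == m = false) ?mulr0 //; apply: contraNF mf => /eqP <-.
Qed.

Lemma meval_mscale x y f : (mscale x f).@[y] = f.@[vmul x y].
Proof.
rewrite mscaleE [in RHS](mpolyE f) !linear_sum /=; apply: eq_bigr => m _.
by rewrite !mevalZ mevalX_vmul mulrA.
Qed.

Lemma mscale_eq0 x f : (forall i, x i != 0) -> mscale x f = 0 -> f = 0.
Proof.
move=> x0 xf; apply/mpolyP => m; rewrite mcoeff0.
move/mpolyP: xf => /(_ m); rewrite mcoeff_mscale mcoeff0 => /eqP.
by rewrite mulf_eq0 (negbTE (mevalX_neq0 _ x0)) orbF => /eqP.
Qed.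

Lemma setvpowD S j k x y :
  setvpow S j x -> setvpow S k y -> setvpow S (j + k) (vmul x y).
Proof.
move=> + Sy; elim: j x => [|j IH] x /=; first by move->; rewrite vmul1.
move=> [u [v [Su Sv ->]]]; exists u, (vmul v y); split => //.
  exact: IH.
by rewrite vmulA.
Qed.

(** Dedekind's argument. Given f vanishing on M and a monomial b of f, the
    polynomial [f(x y) - x^b f(y)] in y also vanishes on M and has lost the
    monomial b; by induction on the number of monomials it is 0 for every x in
    M, which forces every monomial of f to agree with b on M. So f has only one
    monomial, and the value at the unit vector shows that its coefficient is
    0. *)
Lemma characters_independent (M : set ('I_n -> K)) f :
  M vone -> (forall x y, M x -> M y -> M (vmul x y)) ->
  (forall a b, (forall x, M x -> 'X_[K, a].@[x] = 'X_[b].@[x]) -> a = b) ->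
  vanish M f -> f = 0.
Proof.
move=> M1 MM Msep; move: {2}(size (msupp f)) (leqnn (size (msupp f))) => k.
elim: k f => [|k IH] f.
  by rewrite leqn0 size_eq0 => /eqP/msuppnil0.
move=> fk Mf; apply/eqP/negPn/negP => f0.
pose b := mlead f; have bf : b \in msupp f by apply: mlead_supp.
have eqb a : a \in msupp f -> a = b.
  move=> af; apply: Msep => x Mx.
  pose g := mscale x f - 'X_[b].@[x] *: f.
  have gE m : g@_m = f@_m * ('X_[m].@[x] - 'X_[b].@[x]).
    by rewrite mcoeffB mcoeff_mscale mcoeffZ mulrBr [X in _ - X]mulrC.
  have : g = 0.
    apply: IH => [|y My]; last first.
      by rewrite mevalB meval_mscale mevalZ !Mf ?mulr0 ?subrr //; apply: MM.
    rewrite -ltnS (leq_trans _ fk) //.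
    apply: (@leq_ltn_trans (size (rem b (msupp f)))); last first.
      by rewrite size_rem // ltn_predL; case: (msupp f) bf.
    apply: uniq_leq_size => [|m]; first exact: msupp_uniq.
    rewrite mem_rem_uniq ?msupp_uniq // inE /= !mcoeff_msupp gE mulf_eq0 negb_or.
    by case/andP=> ->; rewrite subr_eq0 andbT; apply: contraNneq => ->.
  move/mpolyP => /(_ a) /eqP; rewrite gE mcoeff0 mulf_eq0 subr_eq0.
  by move: af; rewrite mcoeff_msupp => /negbTE -> /eqP.
have fE : f = f@_b *: 'X_[b].
  apply/mpolyP => m; rewrite mcoeffZ mcoeffX.
  have [<-|mb] := eqVneq b m; first by rewrite mulr1.
  rewrite mulr0 memN_msupp_eq0 //; apply: contraNN mb => /eqb ->; exact/eqP.
move: (Mf _ M1); rewrite fE mevalZ mevalX_one mulr1 => fb.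
by move: bf; rewrite mcoeff_msupp fb eqxx.
Qed.

Lemma prime_vanishP S : S !=set0 ->
  (forall f g, vanish S (f * g) -> vanish S f \/ vanish S g) ->
  prime_ideal (vanish S).
Proof.
move=> [y Sy] Sprod; split=> //.
- by move=> x _; rewrite meval0.
- by move=> f g Sf Sg x Sx; rewrite mevalD Sf // Sg // addr0.
- by move=> f g Sg x Sx; rewrite mevalM Sg // mulr0.
- by move=> /(_ y Sy)/eqP; rewrite meval1 oner_eq0.
Qed.

Lemma prime_vanish_nonempty S : prime_ideal (vanish S) -> S !=set0.
Proof.
case=> _ _ _ S1 _; apply: contrapT => no; apply: S1 => x Sx.
by case: no; exists x.
Qed.

Lemma prime_vanish1 x : prime_ideal (vanish [set x]).
Proof.
apply: prime_vanishP => [|f g]; first by exists x.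
move=> /(_ x erefl)/eqP; rewrite mevalM mulf_eq0.
by move=> /orP[]/eqP e; [left|right] => _ ->.
Qed.

(** The product of two irreducible sets is irreducible: if f and g are nonzero
    at [x y] and [x' y'], then the polynomials [f(. y)] and [g(. y')] do not
    vanish on S, so neither does their product, and a common point s of
    nonvanishing gives [f(s .)] and [g(s .)], whose product does not vanish on
    T. *)
Lemma prime_vanishM S T : prime_ideal (vanish S) -> prime_ideal (vanish T) ->
  prime_ideal (vanish (setvmul S T)).
Proof.
move=> Spr Tpr; have [[_ _ _ _ Sp] [_ _ _ _ Tp]] := (Spr, Tpr).
apply: prime_vanishP => [|f g fg].
  have [x Sx] := prime_vanish_nonempty Spr.
  by have [y Ty] := prime_vanish_nonempty Tpr; exists (vmul x y), x, y.
apply: contrapT => /not_orP[nf ng].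
have wit h : ~ vanish (setvmul S T) h ->
    exists2 y, T y & ~ vanish S (mscale y h).
  move=> nh; apply: contrapT => no; apply: nh => _ [x [y [Sx Ty ->]]].
  apply: contrapT => hxy; apply: no; exists y => // /(_ x Sx).
  by rewrite meval_mscale vmulC.
have [y Ty ny] := wit f nf; have [z Tz nz] := wit g ng.
have : ~ vanish S (mscale y f * mscale z g) by move=> /Sp[].
apply => x Sx; rewrite mevalM !meval_mscale ![vmul _ x]vmulC -!meval_mscale.
have : vanish T (mscale x f * mscale x g).
  by move=> t Tt; rewrite -rmorphM meval_mscale; apply: fg; exists x, t.
by case/Tp => [/(_ y Ty)|/(_ z Tz)] ->; rewrite ?mul0r ?mulr0.
Qed.

Lemma prime_vanishX S k : prime_ideal (vanish S) ->
  prime_ideal (vanish (setvpow S k)).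
Proof.
move=> Sp; elim: k => [|k IH] /=; first exact: prime_vanish1.
exact: prime_vanishM.
Qed.

(** Chain stabilization turns independence on the whole generated monoid into
    density of a single power. *)
Lemma setvpow_dense1 S : prime_ideal (vanish S) -> S vone ->
  (forall a b, (forall x, S x -> 'X_[K, a].@[x] = 'X_[b].@[x]) -> a = b) ->
  exists k, forall f, vanish (setvpow S k.+1) f -> f = 0.
Proof.
move=> Sp S1 Ssep.
have Pdec k f : vanish (setvpow S k.+1) f -> vanish (setvpow S k) f.
  by move=> Sf x Sx; apply: Sf; exists vone, x; rewrite vmul1.
have [k kP] := prime_dcc_mpoly (fun k => prime_vanishX k Sp) Pdec.
exists k => f /Pdec/kP Sf.
apply: (@characters_independent [set x | exists j, setvpow S j x]).
- by exists 0%N.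
- by move=> x y [i Sx] [j Sy]; exists (i + j)%N; apply: setvpowD.
- move=> a b ab; apply: Ssep => x Sx; apply: ab; exists 1%N => /=.
  by exists x, vone; rewrite vmulC vmul1.
- by move=> x [j Sx]; apply: Sf Sx.
Qed.

(** Reduction to the previous lemma by dividing S by p. Two monomials a and b
    that agree on S / p yield the binomial [p^b x^a - p^a x^b] vanishing on
    S. *)
Lemma setvpow_dense S p : prime_ideal (vanish S) ->
  S p -> (forall i, p i != 0) ->
  (forall (c d : K) (a b : 'X_{1..n}), c != 0 -> d != 0 -> a != b ->
     ~ vanish S (c *: 'X_[a] + d *: 'X_[b])) ->
  exists k, forall f, vanish (setvpow S k.+1) f -> f = 0.
Proof.
move=> Sp Sp0 p0 nobin.
pose q : 'I_n -> K := fun i => (p i)^-1.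
have qp : vmul q p = vone by apply/funext => i; rewrite /vmul mulVf.
have pq : vmul p q = vone by rewrite vmulC.
pose D := [set x | S (vmul p x)].
have vD f : vanish D f <-> vanish S (mscale q f).
  split=> [Df x Sx | Sf x Dx].
    by rewrite meval_mscale; apply: Df; rewrite /D /= vmulA pq vmul1.
  by have := Sf _ Dx; rewrite meval_mscale vmulA qp vmul1.
have Dp : prime_ideal (vanish D).
  have -> : vanish D = fun f => vanish S (mscale q f).
    by apply/funext => f; apply/propext.
  exact: (prime_ideal_preim (mscale q : {rmorphism _ -> _})).
have D1 : D vone by rewrite /D /= vmulC vmul1.
have [a b ab|k kP] := setvpow_dense1 Dp D1.
  apply: contrapT => /eqP nab.
  apply: (nobin 'X_[b].@[p] (- 'X_[a].@[p]) a b) => //.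
  - exact: mevalX_neq0.
  - by rewrite oppr_eq0 mevalX_neq0.
  move=> x Sx; have := ab (vmul q x); rewrite /D /= vmulA pq vmul1 => /(_ Sx).
  have -> : x = vmul p (vmul q x) by rewrite vmulA pq vmul1.
  rewrite !mevalD !mevalZ !(mevalX_vmul _ p) vmulA qp vmul1 => ->.
  by rewrite mulNr mulrCA subrr.
pose pk j : 'I_n -> K := fun i => p i ^+ j.
have Dk j x : setvpow D j x -> setvpow S j (vmul (pk j) x).
  elim: j x => [|j IH] x /=.
    by move=> ->; apply/funext => i; rewrite /vmul mulr1.
  move=> [u [v [Du /IH Sv ->]]]; exists (vmul p u), (vmul (pk j) v).
  by split=> //; apply/funext => i; rewrite /vmul /pk exprS mulrACA.
exists k => f Sf; apply: (@mscale_eq0 (pk k.+1)).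
  by move=> i; rewrite expf_neq0.
by apply: kP => x Dx; rewrite meval_mscale; apply/Sf/Dk.
Qed.

End Affine.

(** * Auxiliary facts on ranks, roots and points *)

Lemma setvpowP (K : fieldType) n (S : set ('I_n -> K)) k x :
  setvpow S k x <->
  exists u : 'I_k -> 'I_n -> K,
    (forall j, S (u j)) /\ forall i, x i = \prod_(j < k) u j i.
Proof.
elim: k x => [|k IH] x /=; split.
- move=> ->; exists (fun=> @vone K n); split; first by case.
  by move=> i; rewrite big_ord0.
- by move=> [u [_ xu]]; apply/funext => i; rewrite xu big_ord0.
- move=> [y [z [Sy /IH[u [Su zu]] ->]]].
  exists (fun j => if unlift ord0 j is Some j' then u j' else y); split.
    by move=> j; case: unliftP.
  move=> i; rewrite big_ord_recl unlift_none /vmul zu; congr (_ * _).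
  by apply: eq_bigr => j _; rewrite liftK.
- move=> [u [Su xu]]; exists (u ord0), (fun i => \prod_(j < k) u (lift ord0 j) i).
  split => //; last by apply/funext => i; rewrite xu big_ord_recl.
  by apply/IH; exists (fun j => u (lift ord0 j)).
Qed.

Lemma least_None (P : nat -> Prop) : least P = None <-> forall n, ~ P n.
Proof.
rewrite /least; case: pselect => [exP|noP]; split=> //.
- by move=> no; have [n /asboolP] := exP; move/no.
- by move=> _ n Pn; apply: noP; exists n; apply/asboolP.
Qed.

Lemma least_Some (P : nat -> Prop) k : least P = Some k -> P k.
Proof.
by rewrite /least; case: pselect => // exP [<-]; case: ex_minnP => m /asboolP.
Qed.

Lemma least_le (P : nat -> Prop) n :
  P n -> exists2 k, least P = Some k & (k <= n)%N.
Proof.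
move=> Pn; rewrite /least; case: pselect => [exP|[]]; last first.
  by exists n; apply/asboolP.
exists (ex_minn exP) => //; case: ex_minnP => m _; apply; exact/asboolP.
Qed.

Lemma poly_eq0_nonzero_roots (K : numFieldType) (q : {poly K}) :
  (forall t, t != 0 -> q.[t] = 0) -> q = 0.
Proof.
move=> q0; apply/eqP/negPn/negP => qn0.
pose rs := [seq i.+1%:R : K | i <- iota 0 (size q)].
have : (size rs < size q)%N.
  apply: max_poly_roots => //.
    by apply/allP => _ /mapP[i _ ->]; rewrite rootE q0 // pnatr_eq0.
  rewrite map_inj_uniq ?iota_uniq // => i j /eqP.
  by rewrite eqr_nat eqSS => /eqP.
by rewrite size_map size_iota ltnn.
Qed.

Lemma meval_homog (K : comNzRingType) n d (f : {mpoly K[n]}) c (x : 'I_n -> K) :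
  f \is d.-homog -> f.@[fun i => c * x i] = c ^+ d * f.@[x].
Proof.
move=> /dhomogP fd; rewrite !mevalE mulr_sumr big_seq [RHS]big_seq.
apply: eq_bigr => m /fd <-; rewrite mulrCA; congr (_ * _).
under eq_bigr do rewrite exprMn.
by rewrite big_split /= mdegE -expr_sum.
Qed.

Lemma pt_eq (K : fieldType) N (u v : nzvec K N) :
  pt u = pt v <-> exists2 c, c != 0 & hc u = fun i => c * hc v i.
Proof.
split.
- move/eqmodP => /asboolP[c c0 uv]; exists c => //.
  by apply/funext => i; rewrite /hc uv mxE.
- move=> [c c0 uv]; apply/eqmodP/asboolP; exists c => //.
  by apply/rowP => i; rewrite mxE; move: (congr1 (@^~ i) uv).
Qed.

Lemma pt_surj (K : fieldType) N (p : pspace K N) : exists v, p = pt v.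
Proof. by exists (repr p); rewrite /pt reprK. Qed.

Lemma nzvec_neq0 (K : fieldType) N (v : nzvec K N) : exists i, hc v i != 0.
Proof.
by have /rV0Pn[i vi] := valP v; exists i.
Qed.

Lemma nzvec_of (K : fieldType) N (x : 'I_N.+1 -> K) i :
  x i != 0 -> exists v : nzvec K N, hc v = x.
Proof.
move=> xi; have x0 : \row_j x j != 0.
  by apply: contraNneq xi => /rowP/(_ i); rewrite !mxE => ->.
by exists (exist (fun v => is_true (v != 0)) _ x0); apply/funext => j; rewrite /hc mxE.
Qed.

Lemma vanishes_pt (K : fieldType) N (f : {mpoly K[N.+1]}) (v : nzvec K N) :
  homogeneous f -> (vanishes f (pt v) <-> f.@[hc v] = 0).
Proof.
move=> [d fd]; split=> [|fv u /pt_eq[c c0 ->]]; first exact.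
by rewrite (meval_homog _ _ fd) fv mulr0.
Qed.

(** * The affine cone over a projective set *)

Section Projective.
Variables (K : numFieldType) (N : nat).
Implicit Types (X A B : set (pspace K N)) (f g : {mpoly K[N.+1]}).

Definition cone X : set ('I_N.+1 -> K) :=
  [set x | exists2 v, X (pt v) & x = hc v].

Lemma vanish_cone X f : vanish (cone X) f <-> ideal_of X f.
Proof.
split=> [Xf p Xp v vp | Xf _ [v Xv ->]]; last exact: Xf Xv _ erefl.
by apply: Xf; exists v; rewrite ?vp.
Qed.

Lemma coneZ X c x : c != 0 -> cone X x -> cone X (fun i => c * x i).
Proof.
move=> c0 [v Xv ->]; have [i vi] := nzvec_neq0 v.
have [|w wE] := @nzvec_of _ N (fun i => c * hc v i) i; first exact: mulf_neq0.
by exists w => //; rewrite (_ : pt w = pt v) //; apply/pt_eq; exists c.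
Qed.

Lemma subset_zclosure A : A `<=` zclosure A.
Proof. by move=> p Ap B _; apply. Qed.

Lemma zclosure_sub A B : zclosed B -> A `<=` B -> zclosure A `<=` B.
Proof. by move=> Bcl AB p; apply. Qed.

Lemma zclosed_zero_locus1 f : homogeneous f -> zclosed (zero_locus [set f]).
Proof. by move=> fh; exists [set f] => // _ ->. Qed.

(** The polynomial [f(t x)] in t. Its coefficients are the values at x of the
    homogeneous components of f, which is how homogeneous equations describe
    the lines on which an arbitrary f vanishes. *)
Definition on_line (x : 'I_N.+1 -> K) : {mpoly K[N.+1]} -> {poly K} :=
  mmap polyC (fun i => x i *: 'X).

HB.instance Definition _ x := GRing.RMorphism.on (on_line x).

Lemma on_lineE x f : on_line x f =
  \sum_(m <- msupp f) (f@_m * 'X_[m].@[x]) *: 'X^(mdeg m).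
Proof.
apply: eq_bigr => m _; rewrite mul_polyC -scalerA; congr (_ *: _).
rewrite /mmap1 mevalX mdegE; under [LHS]eq_bigr do rewrite exprZn.
by rewrite scaler_prod -expr_sum.
Qed.

Lemma horner_on_line x f t : (on_line x f).[t] = f.@[fun i => t * x i].
Proof.
rewrite on_lineE horner_sum mevalE; apply: eq_bigr => m _.
rewrite hornerZ hornerXn mevalX -mulrA; congr (_ * _).
under [RHS]eq_bigr do rewrite exprMn.
by rewrite big_split /= mdegE -expr_sum mulrC.
Qed.

Lemma coef_on_line x f d : (on_line x f)`_d = (pihomog mdeg d f).@[x].
Proof.
rewrite on_lineE coef_sum pihomogE linear_sum /= [RHS]big_mkcond.
apply: eq_bigr => m _; rewrite coefZ coefXn eq_sym mevalZ.
by case: eqP; rewrite ?mulr1 ?mulr0.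
Qed.

Lemma on_line_eq0 x f : (forall t, t != 0 -> f.@[fun i => t * x i] = 0) ->
  on_line x f = 0.
Proof.
by move=> f0; apply: poly_eq0_nonzero_roots => t t0; rewrite horner_on_line f0.
Qed.

Definition components f : set {mpoly K[N.+1]} :=
  [set g | exists d, g = pihomog mdeg d f].

Lemma components_homog f : components f `<=` @homogeneous K N.
Proof. by move=> _ [d ->]; exists d; apply: pihomogP. Qed.

Lemma on_line_components f (v : nzvec K N) :
  on_line (hc v) f = 0 <-> zero_locus (components f) (pt v).
Proof.
split=> [f0 _ [d ->]|f0].
  by apply/vanishes_pt; [exists d; apply: pihomogP | rewrite -coef_on_line f0 coef0].
apply/polyP => d; rewrite coef_on_line coef0.
by apply: (f0 _ (ex_intro _ d erefl)).
Qed.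

(** Irreducibility of X only speaks of homogeneous equations. If f g vanishes on
    the cone, then on each line one of [f(t x)], [g(t x)] is the zero
    polynomial in t, so X is covered by the two closed sets cut out by the
    homogeneous components of f and of g. *)
Lemma prime_cone X : zirreducible X -> prime_ideal (vanish (cone X)).
Proof.
move=> [[p Xp] irr]; apply: prime_vanishP => [|f g fg].
  by have [v pv] := pt_surj p; exists (hc v), v; rewrite -?pv.
have sub h : X `<=` zero_locus (components h) -> vanish (cone X) h.
  move=> Xh _ [v Xv ->]; have /on_line_components lh := Xh _ Xv.
  rewrite (_ : hc v = fun i => 1 * hc v i); last first.
    by apply/funext => i; rewrite mul1r.
  by rewrite -horner_on_line lh horner0.
have cl h : zclosed (zero_locus (components h)).
  by exists (components h) => //; apply: components_homog.
have [q Xq| |] := irr _ _ (cl f) (cl g); last 2 first.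
- by left; apply: sub.
- by right; apply: sub.
have [v qv] := pt_surj q; rewrite qv in Xq *.
have /eqP : on_line (hc v) (f * g) = 0.
  by apply: on_line_eq0 => t t0; apply: fg; apply: coneZ => //; exists v.
rewrite rmorphM mulf_eq0 => /orP[]/eqP l0; [left|right];
  exact/on_line_components.
Qed.

(** No coordinate is zero on the whole cone and the ideal of the cone is prime,
    so the product of all the coordinates does not vanish identically. *)
Lemma cone_torus_point X : zirreducible X -> concise X ->
  exists2 p, cone X p & forall i, p i != 0.
Proof.
move=> /prime_cone[_ _ _ X1 Xp] con.
have nX i : ~ vanish (cone X) 'X_i.
  move=> /vanish_cone Xi; apply: (con i) => p Xpp _ ->; exact: Xi.
have : ~ vanish (cone X) (\prod_(i < N.+1) 'X_i).
  elim/big_ind: _ => //; first by move=> f g nf ng /Xp[].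
move=> np; apply: contrapT => no; apply: np => x Xx.
have [i /eqP xi] : exists i, x i == 0.
  apply: contrapT => ni; apply: no; exists x => // i.
  by apply/negP => xi; apply: ni; exists i.
by rewrite rmorph_prod /= (bigD1 i) //= mevalXU xi mul0r.
Qed.

Lemma exp2_inj : injective (fun k => (2%:R : K) ^+ k).
Proof. by apply: ieexprIn; rewrite ?ltr0n // (eqr_nat K 2 1). Qed.

(** The torus is a monoid on which monomials are distinct characters, as the
    points with one coordinate 2 and the others 1 show. *)
Lemma nonvanishing_torus_point f :
  f != 0 -> exists2 x, (forall i, x i != 0) & f.@[x] != 0.
Proof.
move=> /eqP f0; apply: contrapT => no; apply: f0.
apply: (@characters_independent _ _ [set x | forall i, x i != 0]).
- by move=> i; apply: oner_neq0.
- by move=> x y x0 y0 i; apply: mulf_neq0.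
- move=> a b ab; apply/mnmP => i.
  pose x (j : 'I_N.+1) : K := if j == i then 2%:R else 1.
  have x0 j : x j != 0 by rewrite /x; case: ifP; rewrite ?oner_neq0 ?pnatr_eq0.
  have xE m : ('X_[m] : {mpoly K[N.+1]}).@[x] = 2%:R ^+ m i.
    rewrite mevalX (bigD1 i) //= /x eqxx big1 ?mulr1 // => j /negbTE ->.
    by rewrite expr1n.
  by apply: exp2_inj; rewrite -!xE; apply: ab.
- by move=> x x0; apply/eqP/negPn/negP => fx; apply: no; exists x.
Qed.

(** * Powers of a set contained in a binomial hypersurface *)

Lemma zero_locus1_proper f : homogeneous f -> f != 0 ->
  zero_locus [set f] `<` setT.
Proof.
move=> fh f0; split=> // fT.
have [x x0 fx] := nonvanishing_torus_point f0.
have [v vx] := nzvec_of (x0 ord0).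
have /(_ f erefl)/vanishes_pt := fT (pt v) I.
by move=> /(_ fh); rewrite vx => /eqP; rewrite (negbTE fx).
Qed.

Lemma binomial_neq0 f : is_binomial f -> f != 0.
Proof.
move=> [a [b [al [be [a0 b0 nab ->]]]]]; apply/eqP => /mpolyP/(_ al)/eqP.
rewrite mcoeffD !mcoeffZ !mcoeffX eqxx [be == al]eq_sym (negbTE nab) mulr0.
by rewrite addr0 mulr1 mcoeff0 (negbTE a0).
Qed.

Lemma binomial_homog (c d : K) (a b : 'X_{1..N.+1}) : mdeg a = mdeg b ->
  homogeneous (c *: 'X_[a] + d *: 'X_[b]).
Proof.
by move=> ab; exists (mdeg a); apply: rpredD; apply: rpredZ;
  rewrite dhomogX /= ?ab.
Qed.

(** At a point p of the torus both terms of the binomial are nonzero and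
    opposite; this persists at 2p, which multiplies them by different powers of
    2 if the degrees differ. *)
Lemma binomial_ideal_mdeg X (c d : K) (a b : 'X_{1..N.+1}) :
  zirreducible X -> concise X -> c != 0 -> d != 0 ->
  vanish (cone X) (c *: 'X_[a] + d *: 'X_[b]) -> mdeg a = mdeg b.
Proof.
move=> Xirr Xcon c0 d0 Xf; have [p Xp p0] := cone_torus_point Xirr Xcon.
have two0 : 2%:R != 0 :> K by rewrite pnatr_eq0.
have homX m : ('X_[m] : {mpoly K[N.+1]}) \is (mdeg m).-homog by rewrite dhomogX.
have := Xf _ (coneZ two0 Xp); have := Xf _ Xp.
rewrite !mevalD !mevalZ !(meval_homog _ _ (homX _)) => /eqP.
rewrite addr_eq0 => /eqP e1 /eqP; rewrite mulrCA e1 mulrN mulrCA.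
rewrite addrC subr_eq0 => /eqP/(mulfI d0)/(mulIf (mevalX_neq0 _ p0)).
by move/exp2_inj.
Qed.

(** The equation of k-fold products of points at which [c x^a + d x^b = 0], that
    is [c x^a = (- d) x^b]. *)
Definition binomial_power (c d : K) (a b : 'X_{1..N.+1}) k : {mpoly K[N.+1]} :=
  c ^+ k *: 'X_[a] + (- (- d) ^+ k) *: 'X_[b].

Lemma binomial_power_is_binomial (c d : K) (a b : 'X_{1..N.+1}) k :
  c != 0 -> d != 0 -> a != b -> is_binomial (binomial_power c d a b k).
Proof.
move=> c0 d0 ab; exists (c ^+ k), (- (- d) ^+ k), a, b.
by rewrite oppr_eq0 !expf_neq0 ?oppr_eq0.
Qed.

Lemma binomial_power_vmul (c d : K) (a b : 'X_{1..N.+1}) k x y :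
  (c *: 'X_[a] + d *: 'X_[b]).@[x] = 0 ->
  (binomial_power c d a b k).@[y] = 0 ->
  (binomial_power c d a b k.+1).@[vmul x y] = 0.
Proof.
rewrite !mevalD !mevalZ !mevalX_vmul !mulNr => /eqP; rewrite addr_eq0 => /eqP ex.
move/eqP; rewrite subr_eq0 => /eqP ey; apply/eqP; rewrite subr_eq0; apply/eqP.
by rewrite !exprS mulrACA ex ey -mulNr mulrACA.
Qed.

Lemma binomial_power0 (c d : K) (a b : 'X_{1..N.+1}) :
  (binomial_power c d a b 0).@[@vone K N.+1] = 0.
Proof. by rewrite mevalD !mevalZ !mevalX_one !expr0 !mulr1 subrr. Qed.

Section InBinomial.
Variables (X : set (pspace K N)) (c d : K) (a b : 'X_{1..N.+1}).
Hypotheses (c0 : c != 0) (d0 : d != 0) (ab : a != b) (dab : mdeg a = mdeg b).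
Hypothesis Xf : vanish (cone X) (c *: 'X_[a] + d *: 'X_[b]).

Local Notation bp := (binomial_power c d a b).

Let bp_homog k : homogeneous (bp k).
Proof. exact: binomial_homog. Qed.

Let bp_neq0 k : bp k != 0.
Proof. exact/binomial_neq0/binomial_power_is_binomial. Qed.

Lemma setvpow_binomial k x : setvpow (cone X) k x -> (bp k).@[x] = 0.
Proof.
elim: k x => [|k IH] x /=; first by move=> ->; apply: binomial_power0.
move=> [y [z [Xy Xz ->]]]; apply: binomial_power_vmul; last exact: IH.
exact: Xf.
Qed.

Lemma hpower_binomial k : hpower X k `<=` zero_locus [set bp k].
Proof.
elim: k => [|k IH] /=.
  move=> _ [v <- v1] _ ->; apply/vanishes_pt => //.
  by rewrite (_ : hc v = @vone K N.+1) ?binomial_power0 //; apply/funext.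
apply: zclosure_sub; first exact: zclosed_zero_locus1.
move=> _ [p [q [Xp Xq [u [v [w [up vq <- wE]]]]]]] _ ->.
rewrite -up in Xp; rewrite -vq in Xq.
apply/vanishes_pt => //; rewrite (_ : hc w = vmul (hc u) (hc v)); last first.
  exact/funext.
apply: binomial_power_vmul; first by apply: Xf; exists u.
by apply/vanishes_pt => //; apply: IH Xq _ _.
Qed.

Lemma hpower_binomial_proper k : hpower X k `<` setT.
Proof.
have [_ nT] := zero_locus1_proper (bp_homog k) (bp_neq0 k).
by split=> // TX; apply: nT; apply: subset_trans TX (@hpower_binomial k).
Qed.

(** Points of rank j satisfy the j-th binomial, so points of rank at most k lie
    on the zero locus of the product of the first k binomials. *)
Lemma eta_binomial_neqT k : Defs.eta X k <> setT.
Proof.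
pose F := \prod_(j < k) bp j.+1.
have Fh : homogeneous F.
  apply: (big_ind (@homogeneous K N)) => //.
    by exists 0%N; apply: dhomog1.
  by move=> f g [i fi] [j gj]; exists (i + j)%N; apply: dhomogM.
have F0 : F != 0 by apply/prodf_neq0 => j _.
have [_ nT] := zero_locus1_proper Fh F0.
move=> eT; apply: nT; rewrite -eT; apply: zclosure_sub.
  exact: zclosed_zero_locus1.
move=> p [j /least_Some[j0 [q [Xq [u [w [uq wp wE]]]]]] jk] _ ->.
rewrite -wp; apply/vanishes_pt => //.
have jk' : (j.-1 < k)%N by rewrite prednK.
rewrite rmorph_prod /= (bigD1 (Ordinal jk')) //= prednK //.
rewrite setvpow_binomial ?mul0r //; apply/setvpowP.
by exists (fun i => hc (u i)); split=> // i; exists (u i); rewrite ?uq.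
Qed.

End InBinomial.

(** * Density of the powers when no binomial vanishes *)

Definition hproducts X k : set (pspace K N) :=
  [set p | exists2 w, p = pt w & setvpow (cone X) k (hc w)].

(** A nonzero product has nonzero partial products, so it can be formed one
    factor at a time in projective space. *)
Lemma hproducts_hprod X A k : hproducts X k `<=` A ->
  hproducts X k.+1 `<=` [set r | exists p q, [/\ X p, A q & is_hprod p q r]].
Proof.
move=> XA _ [w -> [_ [y [[u Xu ->] Xy wE]]]].
have [i wi] := nzvec_neq0 w.
have yi : y i != 0 by move: wi; rewrite wE /vmul mulf_eq0 negb_or => /andP[].
have [v vy] := nzvec_of yi.
exists (pt u), (pt v); split=> //; first by apply: XA; exists v; rewrite ?vy.
by exists u, v, w; split=> // j; rewrite wE vy.
Qed.

Lemma hproducts_hpower X k : hproducts X k `<=` hpower X k.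
Proof.
elim: k => [|k IH] /=.
  by move=> _ [w -> /= w1]; exists w => // i; rewrite w1.
by move=> p /(hproducts_hprod IH) Xp; apply: subset_zclosure.
Qed.

Lemma hproducts_Hrk X k p : hproducts X k.+1 p ->
  exists2 j, Hrk X p = Some j & (j <= k.+1)%N.
Proof.
move=> [w -> /setvpowP[u [Xu wE]]]; apply: least_le; split=> //.
have Xu' j : exists v, X (pt v) /\ u j = hc v by have [v] := Xu j; exists v.
have [v vP] := choice Xu'.
exists (fun j => pt (v j)); split=> [j|]; first by case: (vP j).
exists v, w; split=> // i; rewrite wE; apply: eq_bigr => j _.
by case: (vP j) => _ ->.
Qed.

Lemma hproducts_dense X k :
  (forall f, vanish (setvpow (cone X) k) f -> f = 0) ->
  forall B, zclosed B -> hproducts X k `<=` B -> B = setT.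
Proof.
move=> dense B [S Sh BE] XB; apply/seteqP; split=> // p _.
have [v ->] := pt_surj p; rewrite BE => f Sf; apply/vanishes_pt; first exact: Sh.
have [i vi] := nzvec_neq0 v.
(* The factor X_i makes the product vanish at the zero vector too, even when f
   is a constant. *)
have : f * 'X_i = 0.
  apply: dense => x Xx; rewrite mevalM mevalXU.
  have [->|xi] := eqVneq (x i) 0; first by rewrite mulr0.
  have [w wx] := nzvec_of xi.
  have : B (pt w) by apply: XB; exists w; rewrite ?wx.
  rewrite BE => /(_ _ Sf w erefl); rewrite wx => ->; exact: mul0r.
move/(congr1 (meval (hc v))); rewrite mevalM mevalXU meval0 => /eqP.
by rewrite mulf_eq0 (negbTE vi) orbF => /eqP.
Qed.

Lemma no_binomial_dense X : zirreducible X -> concise X ->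
  (forall f, is_binomial f -> ~ ideal_of X f) ->
  exists k, hpower X k.+1 = setT /\ Defs.eta X k.+1 = setT.
Proof.
move=> Xirr Xcon nobin; have [p Xp p0] := cone_torus_point Xirr Xcon.
have [|k dense] := setvpow_dense (prime_cone Xirr) Xp p0.
  move=> c d a b c0 d0 ab /vanish_cone; apply: nobin.
  by exists c, d, a, b.
have denseB := hproducts_dense dense.
exists k; split; apply/seteqP; split=> // q _.
- move=> B Bcl AB; rewrite (denseB B) //; apply: subset_trans AB.
  exact/hproducts_hprod/hproducts_hpower.
- by move=> B Bcl AB; rewrite (denseB B) // => r /hproducts_Hrk Xr; apply: AB.
Qed.

End Projective.

(** * The equivalences *)

Theorem corollary3p40 (R : realType) (N : nat) (X : set (pspace R[i] N))
    (Xvar : irreducible_projective_variety X) (Xconcise : concise X) :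
  (generic_Hrk X = None <->
    forall m : nat, (1 <= m)%N -> hpower X m `<` [set: pspace R[i] N]) /\
  (generic_Hrk X = None <->
    exists H : set (pspace R[i] N),
      [/\ binomial_hypersurface H, H `<` [set: pspace R[i] N] & X `<=` H]) /\
  ((exists H : set (pspace R[i] N),
      [/\ binomial_hypersurface H, H `<` [set: pspace R[i] N] & X `<=` H]) <->
    exists f : {mpoly R[i][N.+1]}, is_binomial f /\ ideal_of X f).
Proof.
have [_ Xirr] := Xvar.
pose bin := exists f : {mpoly R[i][N.+1]}, is_binomial f /\ ideal_of X f.
have degE (c d : R[i]) a b : c != 0 -> d != 0 ->
    ideal_of X (c *: 'X_[a] + d *: 'X_[b]) -> mdeg a = mdeg b.
  by move=> c0 d0 /vanish_cone; apply: binomial_ideal_mdeg.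
have hyp : (exists H : set (pspace R[i] N),
    [/\ binomial_hypersurface H, H `<` [set: pspace R[i] N] & X `<=` H]) <-> bin.
  split=> [[_ [[f [fbin fh ->]] _ XH]]|[f [fbin Xf]]].
    by exists f; split=> // p /XH; apply.
  have fh : homogeneous f.
    have [c [d [a [b [c0 d0 _ fE]]]]] := fbin.
    by rewrite fE in Xf *; apply/binomial_homog/(degE c d).
  exists (zero_locus [set f]); split.
  - by exists f.
  - by apply: zero_locus1_proper => //; apply: binomial_neq0.
  - by move=> p Xp _ ->; apply: Xf.
have binP : bin -> (forall m, Defs.eta X m <> setT) /\ (forall m, hpower X m `<` setT).
  move=> [_ [[c [d [a [b [c0 d0 ab ->]]]]] Xf]].
  have dab := degE _ _ _ _ c0 d0 Xf; move/vanish_cone: Xf => Xf.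
  split=> m; first exact: (eta_binomial_neqT c0 d0 ab dab Xf).
  exact: (hpower_binomial_proper c0 d0 ab dab Xf).
have nbinP : ~ bin -> exists k, hpower X k.+1 = setT /\ Defs.eta X k.+1 = setT.
  by move=> nbin; apply: no_binomial_dense => // f fb Xf; apply: nbin; exists f.
have rk_bin : generic_Hrk X = None <-> bin.
  rewrite least_None; split=> [rk|/binP[eT _] m []]; last by move=> _ /eT.
  by apply: contrapT => /nbinP[k [_ eT]]; apply: (rk k.+1).
have pow_bin : (forall m, (1 <= m)%N -> hpower X m `<` setT) <-> bin.
  split=> [pw|/binP[_ pw] m _]; last exact: pw.
  apply: contrapT => /nbinP[k [hT _]]; have [_] := pw k.+1 isT.
  by rewrite hT; apply.
by rewrite rk_bin pow_bin hyp.
Qed.
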